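(* Fix a node $J$ with two incoming and two outgoing arcs, with flux $f$. If $\boldsymbol\theta=\left(\frac12,\frac12,\frac12,\frac12\right)$, then the Riemann solver $\mathcal{RS}_2$ satisfies the entropy inequality $\mathcal F(\mathcal{RS}_2(\rho_{1,0},\dots,\rho_{4,0}),k)\ge0$ for every initial datum $(\rho_{1,0},\dots,\rho_{4,0})\in[0,1]^4$ and every $k\in[0,1]$.
   Context: Flux: $f:[0,1]\to\mathbb R$ is continuous, piecewise smooth, concave, with $f(0)=f(1)=0$, and there is a unique $\sigma\in\,]0,1[$ such that $f$ is strictly increasing on $[0,\sigma[$ and strictly decreasing on $]\sigma,1]$. Convention: $\mathrm{sgn}(0)=0$. Incoming arcs have indices $1,2$, outgoing arcs $3,4$. (E1): a Riemann solver $\mathcal{RS}:[0,1]^4\to[0,1]^4$ satisfies (E1) if $\mathcal F(\mathcal{RS}(\rho_{1,0},\dots,\rho_{4,0}),k)\ge0$ for every initial datum in $[0,1]^4$ and every $k\in[0,1]$, where $\mathcal F(\rho_1,\dots,\rho_4,k)=\sum_{i=1}^2\mathrm{sgn}(\rho_i-k)(f(\rho_i)-f(k))-\sum_{j=3}^4\mathrm{sgn}(\rho_j-k)(f(\rho_j)-f(k))$. Sets of fluxes for an initial datum $(\rho_{1,0},\dots,\rho_{4,0})$: for $i\in\{1,2\}$, $\Omega_i=[0,f(\rho_{i,0})]$ if $\rho_{i,0}\le\sigma$ and $\Omega_i=[0,f(\sigma)]$ if $\rho_{i,0}\ge\sigma$; for $j\in\{3,4\}$, $\Omega_j=[0,f(\sigma)]$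 if $\rho_{j,0}\le\sigma$ and $\Omega_j=[0,f(\rho_{j,0})]$ if $\rho_{j,0}\ge\sigma$. The solver $\mathcal{RS}_2$ for $\boldsymbol\theta=(\theta_1,\theta_2,\theta_3,\theta_4)$ (positive entries, $\theta_1+\theta_2=\theta_3+\theta_4=1$): let $\Gamma_{inc}=\sup\Omega_1+\sup\Omega_2$, $\Gamma_{out}=\sup\Omega_3+\sup\Omega_4$, $\Gamma=\min\{\Gamma_{inc},\Gamma_{out}\}$. Let $I=\{(\gamma_1,\gamma_2)\in\Omega_1\times\Omega_2:\gamma_1+\gamma_2=\Gamma\}$ and $\mathcal J=\{(\gamma_3,\gamma_4)\in\Omega_3\times\Omega_4:\gamma_3+\gamma_4=\Gamma\}$. Let $(\bar\gamma_1,\bar\gamma_2)$ be the orthogonal projection of $(\Gamma\theta_1,\Gamma\theta_2)$ on the closed convex set $I$ and $(\bar\gamma_3,\bar\gamma_4)$ the orthogonal projection of $(\Gamma\theta_3,\Gamma\theta_4)$ on the closed convex set $\mathcal J$. For $i\in\{1,2\}$, $\bar\rho_i=\rho_{i,0}$ if $f(\rho_{i,0})=\bar\gamma_i$, otherwise $\bar\rho_i$ is the solution of $f(\rho)=\bar\gamma_i$ with $\rho\ge\sigma$; for $j\in\{3,4\}$, $\bar\rho_j=\rho_{j,0}$ if $f(\rho_{j,0})=\bar\gamma_j$, otherwise $\bar\rho_j$ is the solution of $f(\rho)=\bar\gamma_j$ with $\rho\le\sigma$. Then $\mathcal{RS}_2(\rho_{1,0},\dots,\rho_{4,0})=(\bar\rho_1,\dots,\bar\rho_4)$.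 *)

(* Defs.v *)
From mathcomp Require Import all_boot all_order all_algebra.
From mathcomp Require Import all_classical all_reals all_analysis.

Set Implicit Arguments.
Unset Strict Implicit.
Unset Printing Implicit Defensive.

Import Order.TTheory GRing.Theory Num.Theory.
Import numFieldNormedType.Exports.

Local Open Scope classical_set_scope.
Local Open Scope ring_scope.

(* Weakest usual meaning: C^1 on ]0, 1[ away from finitely many points, with no
   condition on one-sided limits there.  Piecewise C^n or C^oo implies it. *)
Definition piecewise_smooth (R : realType) (f : R -> R) : Prop :=
  exists s : seq R, forall x : R, x \in `]0, 1[ -> x \notin s ->
    derivable f x 1 /\ {for x, continuous (f^`())%classic}.

Definition unimodal_at (R : realType) (f : R -> R) (sigma : R) : Prop :=
  [/\ sigma \in `]0, 1[,
      {in `[0, sigma[ &, {homo f : x y / x < y}} &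
      {in `]sigma, 1] &, {homo f : x y /~ x < y}}].

(* Only the values of f on [0, 1] matter. *)
Record flux (R : realType) (f : R -> R) : Prop := Flux {
  flux_continuous : {within `[0, 1], continuous f};
  flux_piecewise_smooth : piecewise_smooth f;
  flux_concave : convex_function (`[0, 1]%classic : set R^o) (\- f : R^o -> R^o);
  flux0 : f 0 = 0;
  flux1 : f 1 = 0;
  flux_unimodal : exists! sigma : R, unimodal_at f sigma }.

(* The arcs 1, 2, 3, 4 are the ordinals 0, 1, 2, 3 of 'I_4. *)
Definition incoming (i : 'I_4) : bool := (i < 2)%N.

Notation arc1 := (inord 0 : 'I_4).
Notation arc2 := (inord 1 : 'I_4).
Notation arc3 := (inord 2 : 'I_4).
Notation arc4 := (inord 3 : 'I_4).

Definition admissible (R : realType) (rho : 'I_4 -> R) : Prop :=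
  forall i, rho i \in `[0, 1].

Definition entropy_F (R : realType) (f : R -> R) (rho : 'I_4 -> R) (k : R) : R :=
  \sum_(i | incoming i) Num.sg (rho i - k) * (f (rho i) - f k)
  - \sum_(j | ~~ incoming j) Num.sg (rho j - k) * (f (rho j) - f k).

Definition satisfies_E1 (R : realType) (f : R -> R)
    (RS : ('I_4 -> R) -> 'I_4 -> R) : Prop :=
  forall rho0 : 'I_4 -> R, admissible rho0 ->
  forall k : R, k \in `[0, 1] -> 0 <= entropy_F f (RS rho0) k.

Definition eucl_dist (R : realType) (p q : R * R) : R :=
  Num.sqrt ((p.1 - q.1) ^+ 2 + (p.2 - q.2) ^+ 2).

(* The product norm on R * R is the max norm, hence the explicit Euclidean
   distance. *)
Definition orth_proj (R : realType) (C : set (R * R)) (p : R * R) : R * R :=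
  get [set q | C q /\ forall q', C q' -> eucl_dist p q <= eucl_dist p q'].

Section RS2.
Variables (R : realType) (f : R -> R) (sigma : R) (theta : 'I_4 -> R).
Variable rho0 : 'I_4 -> R.

Definition Omega (i : 'I_4) : set R :=
  if incoming i then
    if rho0 i <= sigma then `[0, f (rho0 i)]%classic else `[0, f sigma]%classic
  else
    if rho0 i <= sigma then `[0, f sigma]%classic else `[0, f (rho0 i)]%classic.

Definition Gamma_inc : R := sup (Omega arc1) + sup (Omega arc2).
Definition Gamma_out : R := sup (Omega arc3) + sup (Omega arc4).
Definition Gamma : R := Num.min Gamma_inc Gamma_out.

Definition flux_pairs (i j : 'I_4) : set (R * R) :=
  [set g | [/\ Omega i g.1, Omega j g.2 & g.1 + g.2 = Gamma]].

Definition gamma_inc : R * R :=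
  orth_proj (flux_pairs arc1 arc2) (Gamma * theta arc1, Gamma * theta arc2).
Definition gamma_out : R * R :=
  orth_proj (flux_pairs arc3 arc4) (Gamma * theta arc3, Gamma * theta arc4).

Definition gamma_bar (i : 'I_4) : R :=
  if incoming i then (if i == arc1 then gamma_inc.1 else gamma_inc.2)
  else (if i == arc3 then gamma_out.1 else gamma_out.2).

Definition RS2 (i : 'I_4) : R :=
  if f (rho0 i) == gamma_bar i then rho0 i
  else if incoming i then
    get [set r | [/\ r \in `[0, 1], sigma <= r & f r = gamma_bar i]]
  else
    get [set r | [/\ r \in `[0, 1], r <= sigma & f r = gamma_bar i]].

End RS2.

(* Main.v *)
Require Import Defs.
From mathcomp Require Import all_boot all_order all_algebra.
From mathcomp Require Import all_classical all_reals all_analysis.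
From mathcomp Require Import ring lra.

(** Write [K = f k] and let [gamma_i] be the flux that the solver sends through
    arc [i].  Since [f] is unimodal, the term [entropy_term f (rho_i) k] depends
    only on [gamma_i], on [K], and on the sides of [sigma] on which [rho_i] and
    [k] lie: it is [|gamma_i - K|] or [K - gamma_i] if [rho_i <= sigma], and
    [gamma_i - K] or [- |gamma_i - K|] if [sigma <= rho_i]; the first value
    holds for [k <= sigma], the second for [sigma <= k].  Moreover the side of
    [rho_i] records whether the arc is saturated, that is, whether [gamma_i] is
    the largest flux [cap_i] of [Omega_i]: a saturated incoming arc ends left of
    [sigma] and any other incoming arc ends right of it, while outgoing arcs
    behave in the opposite way ([RS2_branch]).

    Suppose that [Gamma = Gamma_inc]; the case [Gamma = Gamma_out] is its mirror
    image.  Both incoming arcs are saturated, so both incoming densities are at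
    most [sigma].  If [sigma <= k], the incoming terms add up to [2 K - Gamma],
    and each outgoing term is at most [K - gamma_j]; as the outgoing fluxes also
    add up to [Gamma], the inequality follows.

    If [k <= sigma], the incoming terms add up to
    [|gamma_1 - K| + |gamma_2 - K|], and the outgoing terms are at most
    [|gamma_j - K|].  This is where [theta = (1/2, 1/2, 1/2, 1/2)] matters: the
    projection splits [Gamma] equally unless the arc with the smaller flux is
    saturated ([split_proj]).  An equal split minimises the sum of the distances
    to [K]; otherwise the arc with the smaller flux contributes the signed value
    [gamma_j - K], which compensates for the spread of the two outgoing fluxes
    ([equalized_split_le]). *)

Set Implicit Arguments.
Unset Strict Implicit.
Unset Printing Implicit Defensive.

Import Order.TTheory GRing.Theory Num.Theory.
Import numFieldNormedType.Exports.

Local Open Scope classical_set_scope.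
Local Open Scope ring_scope.

(** * Consequences of unimodality *)

Section UnimodalFlux.
Variables (R : realType) (f : R -> R) (sigma : R).
Hypotheses (f_flux : flux f) (f_sigma : unimodal_at f sigma).

Lemma sigma_itv : 0 < sigma < 1.
Proof. by case: f_sigma => /[!in_itv]. Qed.

(** The monotonicity hypotheses exclude [sigma] itself.  The maximum of [f] over
    [0, 1] is attained somewhere, and it cannot be attained off [sigma], since
    moving halfway towards [sigma] increases [f]. *)
Lemma flux_le_peak (x : R) : 0 <= x <= 1 -> f x <= f sigma.
Proof.
move=> x01; have s01 := sigma_itv; case: f_sigma => _ fi fd.
have [c c01 cmax] := EVT_max ler01 (flux_continuous f_flux).
move: c01; rewrite in_itv /= => c01.
have half_c : 0 <= (c + sigma) / 2 <= 1 by lra.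
have /cmax le_half : (c + sigma) / 2 \in `[0, 1] by rewrite in_itv.
case: (ltgtP c sigma) => cs; last by rewrite -cs; apply: cmax; rewrite in_itv.
- have : f c < f ((c + sigma) / 2) by apply: fi; rewrite ?in_itv /=; lra.
  by rewrite ltNge le_half.
- have : f c < f ((c + sigma) / 2) by apply: fd; rewrite ?in_itv /=; lra.
  by rewrite ltNge le_half.
Qed.

Lemma flux_lt_left (x y : R) : 0 <= x -> x < y -> y <= sigma -> f x < f y.
Proof.
move=> x0 xy ys; have s01 := sigma_itv; case: f_sigma => _ fi _.
have lt_mid : f x < f ((x + y) / 2) by apply: fi; rewrite ?in_itv /=; lra.
case: (ltgtP y sigma) ys => // [ys _|eq_ys _].
  by apply: fi; rewrite ?in_itv //=; lra.
rewrite eq_ys in xy lt_mid *.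
by apply: (lt_le_trans lt_mid); apply: flux_le_peak; lra.
Qed.

Lemma flux_lt_right (x y : R) : sigma <= x -> x < y -> y <= 1 -> f y < f x.
Proof.
move=> sx xy y1; have s01 := sigma_itv; case: f_sigma => _ _ fd.
have lt_mid : f y < f ((x + y) / 2) by apply: fd; rewrite ?in_itv /=; lra.
case: (ltgtP sigma x) sx => // [sx _|eq_sx _].
  by apply: fd; rewrite ?in_itv //=; lra.
rewrite -eq_sx in xy lt_mid *.
by apply: (lt_le_trans lt_mid); apply: flux_le_peak; lra.
Qed.

Lemma flux_le_left (x y : R) : 0 <= x -> x <= y -> y <= sigma -> f x <= f y.
Proof.
move=> x0; rewrite le_eqVlt => /predU1P[-> //|xy ys].
by rewrite ltW // flux_lt_left.
Qed.

Lemma flux_le_right (x y : R) : sigma <= x -> x <= y -> y <= 1 -> f y <= f x.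
Proof.
move=> sx; rewrite le_eqVlt => /predU1P[-> //|xy y1].
by rewrite ltW // flux_lt_right.
Qed.

Lemma flux_ge0 (x : R) : 0 <= x <= 1 -> 0 <= f x.
Proof.
move=> /andP[x0 x1]; have [xs|sx] := leP x sigma.
  by rewrite -(flux0 f_flux) flux_le_left.
by rewrite -(flux1 f_flux) flux_le_right // ltW.
Qed.

Lemma flux_eq_peak (x : R) : 0 <= x <= 1 -> f x = f sigma -> x = sigma.
Proof.
move=> /andP[x0 x1] fx; case: (ltgtP x sigma) => // xs.
  by have := flux_lt_left x0 xs (lexx _); rewrite fx ltxx.
by have := flux_lt_right (lexx _) xs x1; rewrite fx ltxx.
Qed.

(** The flag makes the treatment of incoming and outgoing arcs uniform: the
    [true] branch is the increasing one. *)
Definition on_branch (b : bool) (r : R) : bool :=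
  if b then r <= sigma else sigma <= r.

Lemma flux_onto_branch (b : bool) (v : R) : 0 <= v <= f sigma ->
  exists r, [/\ r \in `[0, 1], on_branch b r & f r = v].
Proof.
move=> v0s; have /andP[s0 s1] := sigma_itv.
have fs0 : 0 <= f sigma by lra.
case: b => /=.
- have [|| c] := @IVT _ f 0 sigma v (ltW s0).
  + apply: continuous_subspaceW (flux_continuous f_flux).
    by apply: subset_itvl; rewrite bnd_simp ltW.
  + by rewrite (flux0 f_flux) min_l ?max_r ?v0s.
  rewrite in_itv /= => c0s fc; exists c; split=> //; last by lra.
  by rewrite in_itv /=; lra.
- have [|| c] := @IVT _ f sigma 1 v (ltW s1).
  + apply: continuous_subspaceW (flux_continuous f_flux).
    by apply: subset_itvr; rewrite bnd_simp ltW.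
  + by rewrite (flux1 f_flux) min_r ?max_l ?v0s.
  rewrite in_itv /= => cs1 fc; exists c; split=> //; last by lra.
  by rewrite in_itv /=; lra.
Qed.

Lemma get_on_branch (b : bool) (v : R) : 0 <= v <= f sigma ->
  let r := get [set r | [/\ r \in `[0, 1], on_branch b r & f r = v]] in
  [/\ 0 <= r <= 1, on_branch b r & f r = v].
Proof. by move=> /(flux_onto_branch b) /getPex[]; rewrite in_itv. Qed.

End UnimodalFlux.

(** * One term of the entropy sum *)

Section EntropyTerm.
Variables (R : realType) (f : R -> R).

Definition entropy_term (r k : R) : R := Num.sg (r - k) * (f r - f k).

Lemma entropy_term_lt (r k : R) : r < k -> entropy_term r k = f k - f r.
Proof. by move=> rk; rewrite /entropy_term ltr0_sg; lra. Qed.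

Lemma entropy_term_gt (r k : R) : k < r -> entropy_term r k = f r - f k.
Proof. by move=> kr; rewrite /entropy_term gtr0_sg; lra. Qed.

Lemma entropy_term_diag (r : R) : entropy_term r r = 0.
Proof. by rewrite /entropy_term !subrr mulr0. Qed.

Lemma entropy_F_arcs (rho : 'I_4 -> R) (k : R) :
  entropy_F f rho k =
    entropy_term (rho arc1) k + entropy_term (rho arc2) k
    - (entropy_term (rho arc3) k + entropy_term (rho arc4) k).
Proof.
rewrite /entropy_F; under eq_bigr do rewrite -/(entropy_term _ _).
under [X in _ - X]eq_bigr do rewrite -/(entropy_term _ _).
rewrite big_mkcond [X in _ - X]big_mkcond /= !big_ord_recl !big_ord0 /= !add0r !addr0.
have ordE (m n : 'I_4) : m = n :> nat -> entropy_term (rho m) k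
    = entropy_term (rho n) k by move=> /val_inj ->.
by congr (_ + _ - (_ + _)); apply: ordE; rewrite inordK.
Qed.

Variable sigma : R.
Hypotheses (f_flux : flux f) (f_sigma : unimodal_at f sigma).

Lemma entropy_term_left_left (r k : R) : 0 <= r <= 1 -> 0 <= k <= 1 ->
  on_branch sigma true r -> k <= sigma -> entropy_term r k = `|f r - f k|.
Proof.
move=> r01 k01 /= rs ks; case: (ltgtP r k) => [rk|kr|->].
- have := @flux_lt_left _ _ _ f_flux f_sigma r k ltac:(lra) rk ks.
  by move=> lt_rk; rewrite entropy_term_lt // distrC gtr0_norm // subr_gt0.
- have := @flux_lt_left _ _ _ f_flux f_sigma k r ltac:(lra) kr rs.
  by move=> lt_kr; rewrite entropy_term_gt // gtr0_norm // subr_gt0.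
- by rewrite entropy_term_diag subrr normr0.
Qed.

Lemma entropy_term_right_right (r k : R) : 0 <= r <= 1 -> 0 <= k <= 1 ->
  on_branch sigma false r -> sigma <= k -> entropy_term r k = - `|f r - f k|.
Proof.
move=> r01 k01 /= sr sk; case: (ltgtP r k) => [rk|kr|->].
- have := @flux_lt_right _ _ _ f_flux f_sigma r k sr rk ltac:(lra).
  by move=> lt_kr; rewrite entropy_term_lt // gtr0_norm ?opprB // subr_gt0.
- have := @flux_lt_right _ _ _ f_flux f_sigma k r sk kr ltac:(lra).
  by move=> lt_rk; rewrite entropy_term_gt // ltr0_norm ?opprK // subr_lt0.
- by rewrite entropy_term_diag subrr normr0 oppr0.
Qed.

Lemma entropy_term_left_right (r k : R) :
  on_branch sigma true r -> sigma <= k -> entropy_term r k = f k - f r.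
Proof.
move=> /= rs sk; case: (ltgtP r k) => [|kr|->]; first exact: entropy_term_lt.
  by lra.
by rewrite entropy_term_diag subrr.
Qed.

Lemma entropy_term_right_left (r k : R) :
  on_branch sigma false r -> k <= sigma -> entropy_term r k = f r - f k.
Proof.
move=> /= sr ks; case: (ltgtP r k) => [rk||->]; last 2 first.
- exact: entropy_term_gt.
- by rewrite entropy_term_diag subrr.
by lra.
Qed.

Lemma entropy_term_le (r k : R) : 0 <= r <= 1 -> 0 <= k <= 1 ->
  k <= sigma -> f r - f k <= entropy_term r k <= `|f r - f k|.
Proof.
move=> r01 k01 ks; have [rs|/ltW sr] := leP r sigma.
  by rewrite entropy_term_left_left ?lexx ?ler_norm.
by rewrite entropy_term_right_left ?lexx ?ler_norm.
Qed.

Lemma entropy_term_ge (r k : R) : 0 <= r <= 1 -> 0 <= k <= 1 ->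
  sigma <= k -> - `|f r - f k| <= entropy_term r k <= f k - f r.
Proof.
move=> r01 k01 sk; have [rs|/ltW sr] := leP r sigma.
  by rewrite entropy_term_left_right // lexx andbT lerNl opprB ler_norm.
by rewrite entropy_term_right_right // lexx -[f k - _]opprB lerN2 ler_norm.
Qed.

End EntropyTerm.

(** * Splitting a total flux between two arcs *)

Section FluxSplitting.
Variable R : realType.
Implicit Types (G K a b : R) (p q : R * R).

(** If the fluxes [g3 < g4] are further apart than [g1] and [g2], then the sum
    of the distances of [g3] and [g4] to [K] may exceed that of [g1] and [g2].
    The signed bound for the smaller flux repairs this: the two upper bounds add
    up to [g1 + g2 - 2 K] for [K <= g4], and to [g3 - g4 < 0] for [g4 < K]. *)
Lemma equalized_split_le K g1 g2 g3 g4 x3 x4 :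
  g1 + g2 = g3 + g4 -> x3 <= `|g3 - K| -> x4 <= `|g4 - K| ->
  (g3 < g4 -> x3 <= g3 - K) -> (g4 < g3 -> x4 <= g4 - K) ->
  x3 + x4 <= `|g1 - K| + `|g2 - K|.
Proof.
move=> eq_g le3 le4 lt3 lt4.
have tri : `|g3 + g4 - 2 * K| <= `|g1 - K| + `|g2 - K|.
  rewrite (_ : _ - _ = (g1 - K) + (g2 - K)); last by lra.
  exact: ler_normD.
have sum_ge0 : 0 <= `|g1 - K| + `|g2 - K| by rewrite addr_ge0.
have le_tri := le_trans (ler_norm _) tri.
have leN_tri : - (g3 + g4 - 2 * K) <= `|g1 - K| + `|g2 - K|.
  by apply: le_trans tri; rewrite -normrN ler_norm.
case: (ltgtP g3 g4) => [lt34|lt43|eq34].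
- have := lt3 lt34; move: le4; case: (ger0P (g4 - K)) => *; lra.
- have := lt4 lt43; move: le3; case: (ger0P (g3 - K)) => *; lra.
- move: le3 le4; rewrite -eq34 in le_tri leN_tri *.
  case: (ger0P (g3 - K)) => *; lra.
Qed.

(** On the line [q.1 + q.2 = G], the distance to the midpoint is the gap
    between the two coordinates, up to a constant factor. *)
Lemma eucl_dist_midpoint_le G q q' : q.1 + q.2 = G -> q'.1 + q'.2 = G ->
  (eucl_dist (G * (1 / 2), G * (1 / 2)) q
     <= eucl_dist (G * (1 / 2), G * (1 / 2)) q')
  = (`|q.1 - q.2| <= `|q'.1 - q'.2|).
Proof.
case: q q' => [x y] [x' y'] /= eqG eqG'; rewrite /eucl_dist /=.
rewrite ler_sqrt ?addr_ge0 ?sqr_ge0 //.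
rewrite -[RHS]ler_sqr ?nnegrE // !real_normK ?num_real //.
have -> : y = G - x by lra.
have -> : y' = G - x' by lra.
rewrite -[RHS](@ler_pM2r _ (1 / 2)); last by lra.
by congr (_ <= _); field.
Qed.

Definition splits a b G : set (R * R) :=
  [set g | [/\ 0 <= g.1 <= a, 0 <= g.2 <= b & g.1 + g.2 = G]].

Lemma split_proj_ex a b G : 0 <= a -> 0 <= b -> 0 <= G <= a + b ->
  exists q, splits a b G q /\ forall q', splits a b G q' ->
    eucl_dist (G * (1 / 2), G * (1 / 2)) q
      <= eucl_dist (G * (1 / 2), G * (1 / 2)) q'.
Proof.
move=> a0 b0 /andP[G0 Gab].
(* It suffices to minimise the gap between the two coordinates. *)
suff [q Cq min_q] : exists2 q, splits a b G q &
    forall q', splits a b G q' -> `|q.1 - q.2| <= `|q'.1 - q'.2|.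
  exists q; split=> // q' Cq'; case: (Cq) (Cq') => _ _ eqG [_ _ eqG'].
  by rewrite eucl_dist_midpoint_le // min_q.
have [aG|Ga] := ltP a (G / 2).
  exists (a, G - a); first by split=> /=; lra.
  move=> [x y] [/= xa yb eqG]; rewrite !ler0_norm; lra.
have [bG|Gb] := ltP b (G / 2).
  exists (G - b, b); first by split=> /=; lra.
  move=> [x y] [/= xa yb eqG]; rewrite !ger0_norm; lra.
exists (G / 2, G / 2); first by split=> /=; lra.
by move=> q' _; rewrite /= subrr normr0.
Qed.

(** If the arc with the smaller flux were not saturated, then flux could be
    moved to it from the other arc, which would bring the pair closer to the
    midpoint. *)
Lemma split_proj a b G : 0 <= a -> 0 <= b -> 0 <= G <= a + b ->
  let q := orth_proj (splits a b G) (G * (1 / 2), G * (1 / 2)) in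
  [/\ splits a b G q, q.1 < q.2 -> q.1 = a & q.2 < q.1 -> q.2 = b].
Proof.
move=> a0 b0 Gab /=; have := getPex (split_proj_ex a0 b0 Gab).
rewrite -/(orth_proj _ _); move: (orth_proj _ _) => [x y] [Cq min_q].
have [/= xa yb eqG] := Cq; split=> // [xy|yx]; apply/eqP.
- have [lt_xa|?|//] := ltgtP x a; last by lra.
  pose m := Num.min a (G / 2).
  have m_a : m <= a by rewrite ge_min lexx.
  have m_G : m <= G / 2 by rewrite ge_min lexx orbT.
  have x_m : x < m by rewrite lt_min lt_xa /=; lra.
  have Cm : splits a b G (m, G - m) by split=> /=; lra.
  have := min_q _ Cm; rewrite eucl_dist_midpoint_le //=; last by lra.
  rewrite !ler0_norm; lra.
- have [lt_yb|?|//] := ltgtP y b; last by lra.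
  pose m := Num.min b (G / 2).
  have m_b : m <= b by rewrite ge_min lexx.
  have m_G : m <= G / 2 by rewrite ge_min lexx orbT.
  have y_m : y < m by rewrite lt_min lt_yb /=; lra.
  have Cm : splits a b G (G - m, m) by split=> /=; lra.
  have := min_q _ Cm; rewrite eucl_dist_midpoint_le //=; last by lra.
  rewrite !ger0_norm; lra.
Qed.

End FluxSplitting.

(** * Final densities of the solver and the entropy inequality *)

Section Solver.
Variables (R : realType) (f : R -> R) (sigma : R) (rho0 : 'I_4 -> R).
Hypotheses (f_flux : flux f) (f_sigma : unimodal_at f sigma).
Hypothesis rho0_adm : admissible rho0.

(** The right end of [Omega i].  The test holds in the two cases where the
    initial density itself limits the flux. *)
Definition cap (i : 'I_4) : R :=
  if incoming i == (rho0 i <= sigma) then f (rho0 i) else f sigma.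

Lemma cap_ge0 i : 0 <= cap i.
Proof.
have s01 := sigma_itv f_sigma; have := rho0_adm i; rewrite in_itv /= => r01.
by rewrite /cap; case: ifP => _; apply: (flux_ge0 f_flux f_sigma) => //; lra.
Qed.

Lemma cap_le_peak i : cap i <= f sigma.
Proof.
have := rho0_adm i; rewrite in_itv /= => r01.
by rewrite /cap; case: ifP => _ //; apply: (flux_le_peak f_flux f_sigma).
Qed.

Lemma Omega_cap i : Omega f sigma rho0 i = `[0, cap i]%classic.
Proof. by rewrite /Omega /cap; case: (incoming i); case: (rho0 i <= sigma). Qed.

Lemma sup_Omega i : sup (Omega f sigma rho0 i) = cap i.
Proof. by rewrite Omega_cap sup_itv // bnd_simp cap_ge0. Qed.

Local Notation Gamma := (Gamma f sigma rho0).
Local Notation gamma := (gamma_bar f sigma (fun=> 1 / 2) rho0).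
Local Notation rho := (RS2 f sigma (fun=> 1 / 2) rho0).

Lemma Gamma_min :
  Gamma = Num.min (cap arc1 + cap arc2) (cap arc3 + cap arc4).
Proof. by rewrite /Defs.Gamma /Gamma_inc /Gamma_out !sup_Omega. Qed.

Lemma flux_pairs_splits i j :
  flux_pairs f sigma rho0 i j = splits (cap i) (cap j) Gamma.
Proof.
apply/seteqP; split=> g; rewrite /flux_pairs /splits !Omega_cap /= !in_itv /=;
  by case.
Qed.

Definition balanced (i j : 'I_4) : Prop :=
  [/\ splits (cap i) (cap j) Gamma (gamma i, gamma j),
      gamma i < gamma j -> gamma i = cap i &
      gamma j < gamma i -> gamma j = cap j].

Lemma balanced_pair i j : 0 <= Gamma <= cap i + cap j ->
  (gamma i, gamma j) = orth_proj (flux_pairs f sigma rho0 i j)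
                         (Gamma * (1 / 2), Gamma * (1 / 2)) ->
  balanced i j.
Proof.
move=> Gij; rewrite flux_pairs_splits => eq_g.
have := split_proj (cap_ge0 i) (cap_ge0 j) Gij.
by rewrite /= -eq_g.
Qed.

Lemma Gamma_itv :
  [/\ 0 <= Gamma, Gamma <= cap arc1 + cap arc2 & Gamma <= cap arc3 + cap arc4].
Proof.
rewrite Gamma_min; split; last 2 first.
- by rewrite ge_min lexx.
- by rewrite ge_min lexx orbT.
by rewrite le_min !addr_ge0 ?cap_ge0.
Qed.

Lemma balanced_inc : balanced arc1 arc2.
Proof.
have [G0 G12 _] := Gamma_itv.
apply: balanced_pair; rewrite ?G0 //.
rewrite /gamma_bar /incoming !inordK //= eqxx -val_eqE /= !inordK //=.
by rewrite -/(gamma_inc _ _ (fun=> 1 / 2) _) -surjective_pairing.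
Qed.

Lemma balanced_out : balanced arc3 arc4.
Proof.
have [G0 _ G34] := Gamma_itv.
apply: balanced_pair; rewrite ?G0 //.
rewrite /gamma_bar /incoming !inordK //= eqxx -val_eqE /= !inordK //=.
by rewrite -/(gamma_out _ _ (fun=> 1 / 2) _) -surjective_pairing.
Qed.

(** The solver moves a density only to the branch [~~ incoming i].  A density
    that it keeps although [f (rho0 i) < cap i] is already there, because then
    [cap i] is the peak value instead of [f (rho0 i)].  Full capacity is reached
    by keeping a density of the branch [incoming i] or at [sigma], which belongs
    to both branches. *)
Lemma RS2_branch i : 0 <= gamma i <= cap i ->
  [/\ 0 <= rho i <= 1, f (rho i) = gamma i,
      gamma i = cap i -> on_branch sigma (incoming i) (rho i) &
      gamma i < cap i -> on_branch sigma (~~ incoming i) (rho i)].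
Proof.
move=> gi; have := rho0_adm i; rewrite in_itv /= => r01.
rewrite /RS2 /=; case: eqP => [eq_g|neq_g].
  rewrite -eq_g; split=> //; rewrite /cap;
    case: (incoming i); case: (leP (rho0 i) sigma) => //= side.
  - by move/(flux_eq_peak f_flux f_sigma r01) ->.
  - by move/(flux_eq_peak f_flux f_sigma r01) ->.
  - by rewrite ltW.
  - by rewrite ltxx.
  - by rewrite ltW.
  - by rewrite ltxx.
have g_peak : 0 <= gamma i <= f sigma.
  by have := cap_le_peak i; move: gi; lra.
(* A modified density at full capacity can only be [sigma]. *)
have at_cap r : 0 <= r <= 1 -> f r = gamma i -> gamma i = cap i -> r = sigma.
  move=> r'01 fr g_cap; apply: (flux_eq_peak f_flux f_sigma r'01).
  rewrite fr g_cap; move: g_cap; rewrite /cap.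
  by case: ifP => // _ /esym.
have := get_on_branch f_flux f_sigma (~~ incoming i) g_peak.
case: (incoming i) => /= -[r'01 side fr]; split=> //;
  by move/(at_cap _ r'01 fr) ->; rewrite /on_branch.
Qed.

Lemma final_densities (i j : 'I_4) : balanced i j ->
  [/\ 0 <= rho i <= 1, 0 <= rho j <= 1 & f (rho i) + f (rho j) = Gamma].
Proof.
case=> -[/= gi gj eqG] _ _.
have [ri fi _ _] := RS2_branch gi; have [rj fj _ _] := RS2_branch gj.
by rewrite fi fj.
Qed.

(** In an unequal pair the arc with the smaller flux is saturated, which by
    [RS2_branch] determines the side of its density. *)
Lemma final_branch_lt (i j : 'I_4) : balanced i j ->
  (f (rho i) < f (rho j) -> on_branch sigma (incoming i) (rho i)) /\
  (f (rho j) < f (rho i) -> on_branch sigma (incoming j) (rho j)).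
Proof.
case=> -[/= gi gj eqG] lt_i lt_j.
have [_ -> cap_i _] := RS2_branch gi; have [_ -> cap_j _] := RS2_branch gj.
by split=> [/lt_i/cap_i|/lt_j/cap_j].
Qed.

Lemma final_branch_full (i j : 'I_4) : balanced i j ->
  Gamma = cap i + cap j ->
  on_branch sigma (incoming i) (rho i) /\ on_branch sigma (incoming j) (rho j).
Proof.
case=> -[/= gi gj eqG] _ _ full.
have [_ _ cap_i _] := RS2_branch gi; have [_ _ cap_j _] := RS2_branch gj.
by split; [apply: cap_i|apply: cap_j]; lra.
Qed.

Lemma entropy_F_ge0 k : 0 <= k <= 1 -> 0 <= entropy_F f rho k.
Proof.
move=> k01; rewrite entropy_F_arcs.
have [r1 r2 G12] := final_densities balanced_inc.
have [r3 r4 G34] := final_densities balanced_out.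
have [lt12 lt21] := final_branch_lt balanced_inc.
have [lt34 lt43] := final_branch_lt balanced_out.
have full_inc := final_branch_full balanced_inc.
have full_out := final_branch_full balanced_out.
have eqG := etrans G12 (esym G34).
rewrite /incoming !inordK //= in lt12 lt21 lt34 lt43 full_inc full_out.
have caseG : Gamma = cap arc1 + cap arc2 \/ Gamma = cap arc3 + cap arc4.
  by rewrite Gamma_min; case: leP; [left|right].
have [ks|/ltW sk] := leP k sigma.
- have le1 := entropy_term_le f_flux f_sigma r1 k01 ks.
  have le2 := entropy_term_le f_flux f_sigma r2 k01 ks.
  have le3 := entropy_term_le f_flux f_sigma r3 k01 ks.
  have le4 := entropy_term_le f_flux f_sigma r4 k01 ks.
  case: caseG => [/full_inc[b1 b2]|/full_out[b3 b4]]; last first.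
    (* Every outgoing term is now the signed difference of fluxes, which bounds
       the incoming terms from below; both pairs have the same total flux. *)
    rewrite (entropy_term_right_left _ b3) //.
    by rewrite (entropy_term_right_left _ b4) //; lra.
  rewrite (entropy_term_left_left f_flux f_sigma r1) //.
  rewrite (entropy_term_left_left f_flux f_sigma r2) // subr_ge0.
  apply: (equalized_split_le eqG); try by lra.
  + by move/lt34 => b3; rewrite (entropy_term_right_left _ b3).
  + by move/lt43 => b4; rewrite (entropy_term_right_left _ b4).
- have le1 := entropy_term_ge f_flux f_sigma r1 k01 sk.
  have le2 := entropy_term_ge f_flux f_sigma r2 k01 sk.
  have le3 := entropy_term_ge f_flux f_sigma r3 k01 sk.
  have le4 := entropy_term_ge f_flux f_sigma r4 k01 sk.
  case: caseG => [/full_inc[b1 b2]|/full_out[b3 b4]].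
    rewrite (entropy_term_left_right _ b1) //.
    by rewrite (entropy_term_left_right _ b2) //; lra.
  rewrite (entropy_term_right_right f_flux f_sigma r3) //.
  rewrite (entropy_term_right_right f_flux f_sigma r4) //.
  (* The two pairs exchange roles and all signs are reversed. *)
  suff : - entropy_term f (rho arc1) k + - entropy_term f (rho arc2) k
      <= `|f (rho arc3) - f k| + `|f (rho arc4) - f k| by lra.
  apply: (equalized_split_le (esym eqG)); try by lra.
  + by move/lt12 => b1; rewrite (entropy_term_left_right _ b1) // opprB.
  + by move/lt21 => b2; rewrite (entropy_term_left_right _ b2) // opprB.
Qed.

End Solver.

Theorem proposition5p5 (R : realType) (f : R -> R) (sigma : R)
    (f_flux : flux f) (f_sigma : unimodal_at f sigma) :
  satisfies_E1 f (RS2 f sigma (fun=> 1 / 2)).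
Proof.
move=> rho0 rho0_adm k; rewrite in_itv /=.
exact: entropy_F_ge0.
Qed.
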